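(* Consider an exact product staircase started at the rank profile $\mathbf k_0=(k_{c,0})_c$, and set $$k_c^{\mathrm{gen}}:=\min\{k\ge k_{c,0}:\ k\ge n_c\ \text{ or }\ \tau(k)>r_c\},\qquad \mathbf k^{\mathrm{gen}}=(k_c^{\mathrm{gen}})_c .$$ Suppose that at every visited profile $\mathbf k$ up to $\mathbf k^{\mathrm{gen}}$ the smoothness assumption holds: if $\mathcal M_{\mathbf k}\ne\varnothing$, there is an open neighborhood of $\mathcal M_{\mathbf k}$ on which $F\mapsto Dc(F)$ has constant rank. Then there is a Lebesgue-null set $\mathcal E\subset\prod_c\mathbb S^{n_c}$ (a finite union of null exceptional cost sets, over the profiles between $\mathbf k_0$ and $\mathbf k^{\mathrm{gen}}$), depending only on $(\mathcal A_c)_c$, $b$ and these profiles, such that for every product cost $C\notin\mathcal E$: (i) no block $c$ is enlarged beyond $k_c^{\mathrm{gen}}$; that is, a block whose rank has reached $k_c^{\mathrm{gen}}$ is not enlarged again; (ii) if block $c$ receives $r_{\mathrm{inc},c}\ge1$ columns per update, with the final update truncated at $k_c^{\mathrm{gen}}$, the total number of accepted block updates is at most $$\sum_{c=1}^q\left\lceil\frac{k_c^{\mathrm{gen}}-k_{c,0}}{r_{\mathrm{inc},c}}\right\rceil ;$$ (iii) the terminal tuple $(F_cF_c^\top)_c$, together with the terminal multiplier $y$, satisfies the primal--dual KKT conditions of the product SDP (primal feasibility, $S_c(y)\succeq0$ and $S_c(y)F_cF_c^\top=0$ for all $c$) and is globally optimal.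
   Context: Let $q,m,n_1,\dots,n_q$ be positive integers, $[q]=\{1,\dots,q\}$, $\mathbb S^n$ the real symmetric $n\times n$ matrices. Fix $b\in\mathbb R^m$ and linear maps $\mathcal A_c:\mathbb S^{n_c}\to\mathbb R^m$ with adjoints $\mathcal A_c^*$; $r_c:=\operatorname{rank}(\mathcal A_c)$, $\tau(k):=k(k+1)/2$. For a product cost $C=(C_c)_c\in\prod_c\mathbb S^{n_c}$ the product SDP is $\min\sum_c\langle C_c,X_c\rangle$ s.t. $\sum_c\mathcal A_c(X_c)=b$, $X_c\succeq0$ $(c\in[q])$; its dual is $\max b^\top y$ s.t. $S_c(y):=C_c-\mathcal A_c^*(y)\succeq0$ $(c\in[q])$. For a rank profile $\mathbf k=(k_c)_c$ of positive integers, factors are $F=(F_c)_c$ with $F_c\in\mathbb R^{n_c\times k_c}$; $c(F):=\sum_c\mathcal A_c(F_cF_c^\top)-b$, $\mathcal M_{\mathbf k}:=\{F:c(F)=0\}$, $Dc(F)[U]=\sum_c\mathcal A_c(F_cU_c^\top+U_cF_c^\top)$. The factored augmented Lagrangian is $\Phi_{\rho,y}(F):=\sum_c\langle C_c,F_cF_c^\top\rangle-\langle y,c(F)\rangle+\frac\rho2\|c(F)\|_2^2$ for $y\in\mathbb R^m$, $\rho>0$. Exact product staircase: starting from profile $\mathbf k_0$ (with $\mathcal M_{\mathbf k_0}\neq\varnothing$), at each visited profile $\mathbf k$ one obtains, for some $y\in\mathbb R^m$ and $\rho>0$, a feasible full-space second-order stationary point $F$ of $\Phi_{\rho,y}$,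 i.e. $c(F)=0$, $\nabla\Phi_{\rho,y}(F)=0$, and $\nabla^2\Phi_{\rho,y}(F)\succeq0$ on the whole direct-sum factor space. Every slack block $S_c(y)$ is then tested with zero tolerance, and precisely the blocks $c$ for which $S_c(y)$ has a negative eigenvalue are enlarged (their rank $k_c$ is increased; each such increase of one block is an accepted block update). The staircase terminates when no slack block has a negative eigenvalue. *)

(* Defs.v *)
(* MathComp / MathComp-Analysis; the reals are an arbitrary [R : realType]. *)
From HB Require Import structures.
From mathcomp Require Import all_boot all_order all_algebra.
From mathcomp Require Import all_classical all_reals all_analysis.
Set Implicit Arguments.
Unset Strict Implicit.
Unset Printing Implicit Defensive.
Import Order.TTheory GRing.Theory Num.Theory.
Import numFieldNormedType.Exports.
Local Open Scope classical_set_scope.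
Local Open Scope ring_scope.

Definition symv (R : realType) (n : nat) : {vspace 'M[R]_n} :=
  fixedSpace (linfun (@trmx R n n)).

(* The vector space of symmetric matrices; [vsval] is its inclusion in
   ['M[R]_n]. *)
Notation symmx R n := (subvs_of (symv R n)).

Section Matrices.
Context {R : realType}.

Lemma symvP n (X : 'M[R]_n) : reflect (X^T = X) (X \in symv R n).
Proof. by apply: (iffP fixedSpaceP); rewrite lfunE. Qed.

Lemma gram_sym n k (F : 'M[R]_(n, k)) : F *m F^T \in symv R n.
Proof. by apply/symvP; rewrite trmx_mul trmxK. Qed.

Lemma dgram_sym n k (F U : 'M[R]_(n, k)) : F *m U^T + U *m F^T \in symv R n.
Proof. by apply/symvP; rewrite linearD /= !trmx_mul !trmxK addrC. Qed.

Lemma sympart_sym n (X : 'M[R]_n) : 2^-1 *: (X + X^T) \in symv R n.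
Proof. by apply/symvP; rewrite linearZ linearD /= trmxK addrC. Qed.

Definition gram n k (F : 'M[R]_(n, k)) : symmx R n := Subvs (gram_sym F).

Definition dgram n k (F U : 'M[R]_(n, k)) : symmx R n :=
  Subvs (dgram_sym F U).

Definition sympart n (X : 'M[R]_n) : symmx R n := Subvs (sympart_sym X).

(* Frobenius inner product; on columns it is [y^T v]. *)
Definition inner m n (X Y : 'M[R]_(m, n)) : R := \tr (X^T *m Y).

Definition entry n (X : symmx R n) (i j : 'I_n) : R := (vsval X : 'M[R]_n) i j.

(* Only used for symmetric [S]. *)
Definition psd n (S : 'M[R]_n) : Prop :=
  forall x : 'cV[R]_n, 0 <= inner x (S *m x).

Definition has_neg_eigenvalue n (S : 'M[R]_n) : Prop :=
  exists2 a : R, a < 0 & eigenvalue S a.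

Lemma adj_sym n m (L : 'Hom(symmx R n, 'cV[R]_m)) (y : 'cV[R]_m) :
  (\matrix_(i, j) inner y (L (sympart (delta_mx i j)))) \in symv R n.
Proof.
apply/symvP/matrixP => i j; rewrite !mxE.
congr (inner y (L _)); apply: val_inj => /=.
by rewrite !trmx_delta addrC.
Qed.

(* The adjoint for [inner], see [adjP]: the (i, j) entry pairs [y] with the image
   of the symmetrized matrix unit, so that the result is symmetric. *)
Definition adj n m (L : 'Hom(symmx R n, 'cV[R]_m)) (y : 'cV[R]_m) :
  symmx R n := Subvs (adj_sym L y).

Lemma innerE m n (X Y : 'M[R]_(m, n)) :
  inner X Y = \sum_i \sum_j X i j * Y i j.
Proof.
rewrite /inner /mxtrace exchange_big; apply: eq_bigr => i _.
by rewrite mxE; apply: eq_bigr => j _; rewrite mxE.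
Qed.

Lemma sympart_id n (X : symmx R n) : sympart (vsval X) = X.
Proof.
apply: val_inj => /=; have /symvP -> := valP X; rewrite -[_ + _]/(vsval X *+ 2).
by rewrite -[X in _ *: X]scaler_nat scalerA mulVf ?scale1r ?pnatr_eq0.
Qed.

Fact inner_linear m n (y : 'M[R]_(m, n)) : linear_for *%R (inner y).
Proof. by move=> a u v; rewrite /inner mulmxDr -scalemxAr linearD linearZ. Qed.

HB.instance Definition _ m n (y : 'M[R]_(m, n)) :=
  GRing.isLinear.Build R 'M[R]_(m, n) R *%R (inner y) (inner_linear y).

Fact sympart_linear n : linear (@sympart n).
Proof.
move=> a X Y; apply: val_inj => /=.
rewrite [(_ + _)^T]linearP /= addrACA -scalerDr.
by rewrite [LHS]scalerDr !scalerA mulrC.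
Qed.

HB.instance Definition _ n :=
  GRing.isLinear.Build R 'M[R]_n (symmx R n) *:%R (@sympart n)
    (@sympart_linear n).

Lemma adjP n m (L : 'Hom(symmx R n, 'cV[R]_m)) (y : 'cV[R]_m)
    (X : symmx R n) :
  inner (vsval (adj L y)) (vsval X) = inner y (L X).
Proof.
rewrite innerE -[X in RHS]sympart_id [vsval X in RHS]matrix_sum_delta.
rewrite !linear_sum; apply: eq_bigr => i _.
rewrite !linear_sum; apply: eq_bigr => j _.
by rewrite !linearZ /= mxE mulrC.
Qed.

End Matrices.

Definition grad (R : realType) (N : nat) (f : 'rV[R]_N -> R^o)
    (x : 'rV[R]_N) : 'rV[R]_N :=
  \row_i 'D_(delta_mx 0 i) f x.

Definition hess (R : realType) (N : nat) (f : 'rV[R]_N -> R^o)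
    (x : 'rV[R]_N) : 'M[R]_N :=
  \matrix_(i, j) 'D_(delta_mx 0 i) ('D_(delta_mx 0 j) f) x.

Notation cost R n := (forall c, symmx R (n c)).

Section Null.
Context {R : realType} {q : nat} (n : 'I_q -> nat).

(* A symmetric matrix is coordinatized by its entries [i <= j]. *)
Definition box (l u : cost R n) : set (cost R n) :=
  [set C | forall c i j, entry (l c) i j <= entry (C c) i j <= entry (u c) i j].

Definition box_volume (l u : cost R n) : R :=
  \prod_(c < q) \prod_(i < n c) \prod_(j < n c | (i <= j)%N)
    (entry (u c) i j - entry (l c) i j).

(* Zero Lebesgue outer measure: countable covers by boxes of arbitrarily small
   total volume.  No measurability of [E] is needed. *)
Definition lebesgue_null (E : set (cost R n)) : Prop :=
  forall e : R, 0 < e ->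
  exists l u : nat -> cost R n,
    [/\ forall t c i j, entry (l t c) i j <= entry (u t c) i j,
        E `<=` \bigcup_t box (l t) (u t) &
        (\sum_(0 <= t <oo) (box_volume (l t) (u t))%:E <= e%:E)%E].

End Null.

Section Staircase.
Context {R : realType} {q m : nat} {n : 'I_q -> nat}.
Variables (b : 'cV[R]_m) (A : forall c, 'Hom(symmx R (n c), 'cV[R]_m)).

Definition slack (C : cost R n) (y : 'cV[R]_m) (c : 'I_q) : symmx R (n c) :=
  C c - adj (A c) y.

Definition sdp_feasible (X : cost R n) : Prop :=
  \sum_c A c (X c) = b /\ forall c, psd (vsval (X c)).

Definition sdp_value (C X : cost R n) : R :=
  \sum_c inner (vsval (C c)) (vsval (X c)).

Definition sdp_optimal (C X : cost R n) : Prop :=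
  sdp_feasible X /\
  forall X', sdp_feasible X' -> sdp_value C X <= sdp_value C X'.

Definition kkt (C X : cost R n) (y : 'cV[R]_m) : Prop :=
  [/\ sdp_feasible X,
      forall c, psd (vsval (slack C y c)) &
      forall c, vsval (slack C y c) *m vsval (X c) = 0].

(* The direct sum of the spaces of [n c] x [k c] matrices is carried by row
   vectors, so that the library's topology, derivatives and dimensions apply;
   [block F c] is the matrix component of [F]. *)
Notation factor k := 'rV[R]_(\sum_c n c * k c)%N.

Definition block (k : 'I_q -> nat) (F : factor k) (c : 'I_q) :
    'M[R]_(n c, k c) :=
  vec_mx (@submxrow R q (fun c => n c * k c)%N 1 F c).

Definition grams (k : 'I_q -> nat) (F : factor k) : cost R n :=
  fun c => gram (block F c).

Definition constr (k : 'I_q -> nat) (F : factor k) : 'cV[R]_m :=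
  \sum_c A c (gram (block F c)) - b.

Definition constr_set (k : 'I_q -> nat) : set (factor k) :=
  [set F | constr F = 0].
Arguments constr_set k : clear implicits.

Definition Dconstr (k : 'I_q -> nat) (F U : factor k) : 'cV[R]_m :=
  \sum_c A c (dgram (block F c) (block U c)).

Fact block_linear (k : 'I_q -> nat) (c : 'I_q) (a : R) (F G : factor k) :
  block (a *: F + G) c = a *: block F c + block G c.
Proof. by apply/matrixP => i j; rewrite !mxE. Qed.

Fact Dconstr_linear (k : 'I_q -> nat) (F : factor k) : linear (Dconstr F).
Proof.
move=> a U V; rewrite /Dconstr scaler_sumr -big_split /=; apply: eq_bigr => c _.
rewrite -linearP; congr (A c _); apply: val_inj => /=.
rewrite block_linear linearP /= mulmxDr mulmxDl -scalemxAr -scalemxAl.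
by rewrite scalerDr addrACA.
Qed.

HB.instance Definition _ (k : 'I_q -> nat) (F : factor k) :=
  GRing.isLinear.Build R (factor k) 'cV[R]_m *:%R (Dconstr F)
    (Dconstr_linear F).

Definition Dconstr_rank (k : 'I_q -> nat) (F : factor k) : nat :=
  \dim (limg (linfun (Dconstr F))).

Definition smooth_profile (k : 'I_q -> nat) : Prop :=
  constr_set k !=set0 ->
  exists O : set (factor k),
    [/\ open O, constr_set k `<=` O &
        exists r : nat, forall F, O F -> Dconstr_rank F = r].

Definition Phi (C : cost R n) (rho : R) (y : 'cV[R]_m) (k : 'I_q -> nat)
    (F : factor k) : R^o :=
  sdp_value C (grams F) - inner y (constr F)
  + rho / 2 * inner (constr F) (constr F).

Definition feasible_sosp (C : cost R n) (rho : R) (y : 'cV[R]_m)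
    (k : 'I_q -> nat) (F : factor k) : Prop :=
  [/\ constr F = 0, grad (Phi C rho y (k := k)) F = 0 &
      psd (hess (Phi C rho y (k := k)) F)].

Record stage := Stage {
  prof : 'I_q -> nat;
  fac : factor prof;
  mult : 'cV[R]_m;
  pen : R }.

Definition flagged (C : cost R n) (s : stage) (c : 'I_q) : Prop :=
  has_neg_eigenvalue (vsval (slack C (mult s) c)).

(* The stages [st 0, ..., st T] visited so far by an exact staircase: it has
   not stopped before stage [T], and [st T] may or may not be terminal.  By how
   much an enlarged block grows is left free. *)
Definition staircase (C : cost R n) (k0 : 'I_q -> nat) (st : nat -> stage)
    (T : nat) : Prop :=
  [/\ prof (st 0%N) =1 k0,
      forall t, (t <= T)%N ->
        0 < pen (st t) /\
        feasible_sosp C (pen (st t)) (mult (st t)) (fac (st t)),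
      forall t, (t < T)%N -> exists c, flagged C (st t) c &
      forall t c, (t < T)%N ->
        (flagged C (st t) c -> (prof (st t) c < prof (st t.+1) c)%N) /\
        (~ flagged C (st t) c -> prof (st t.+1) c = prof (st t) c)].

Definition terminal (C : cost R n) (s : stage) : Prop :=
  forall c, ~ flagged C s c.

Definition updates (st : nat -> stage) (T : nat) : nat :=
  (\sum_(t < T) #|[pred c : 'I_q | prof (st t) c < prof (st t.+1) c]|)%N.

Definition tau (k : nat) : nat := ((k * k.+1) %/ 2)%N.

Definition kgen_pred (k0 : 'I_q -> nat) (c : 'I_q) : pred nat :=
  fun k => (k0 c <= k)%N && ((n c <= k)%N || (\dim (limg (A c)) < tau k)%N).

Fact kgen_ex (k0 : 'I_q -> nat) (c : 'I_q) : exists k, kgen_pred k0 c k.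
Proof. by exists (maxn (k0 c) (n c)); rewrite /kgen_pred leq_maxl leq_maxr. Qed.

Definition kgen (k0 : 'I_q -> nat) (c : 'I_q) : nat := ex_minn (kgen_ex k0 c).

Definition profiles_between (k0 k1 : 'I_q -> nat) : set ('I_q -> nat) :=
  [set k | forall c, (k0 c <= k c <= k1 c)%N].

End Staircase.

Arguments constr_set {R q m n} b A k.
Arguments stage R {q} m n.

(* Main.v *)
Require Import Defs.
From HB Require Import structures.
From mathcomp Require Import all_boot all_order all_algebra.
From mathcomp Require Import all_classical all_reals all_analysis.
From mathcomp Require Import ring lra zify.
Set Implicit Arguments.
Unset Strict Implicit.
Unset Printing Implicit Defensive.
Import Order.TTheory GRing.Theory Num.Theory.
Import numFieldNormedType.Exports.
Local Open Scope classical_set_scope.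
Local Open Scope ring_scope.

(** The argument is a dichotomy inside a single block.

    Let [F] be a feasible second-order stationary point of the augmented
    Lagrangian with multiplier [y], and [S c] the slack block
    [C c - adj (A c) y].  Since the constraint residual vanishes at [F], the
    gradient is the pairing of the slack blocks with [dgram], so stationarity
    says that [S c *m F c = 0] for every [c] ([sosp_stationary]).

    - If the columns of [F c] are dependent, say [F c *m z = 0] with [z] nonzero,
      the direction [x *m z^T] in block [c] is invisible to the constraints to
      first order, and the Hessian along it is a positive multiple of
      [x^T S x]; hence [S c] is positive semidefinite ([rank_deficient_psd]).
    - If the columns of [F c] are independent, [S c] has rank at most
      [n c - k c].  When [kgen c] is at least [n c] this forces [S c = 0].
      Otherwise [C c] lies in the range of [adj (A c)] plus the symmetric
      matrices of rank at most [n c - kgen c], a set of dimension at most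
      [r + tau (n c) - tau (kgen c)] where [r] is the rank of [A c]; this is
      less than [tau (n c)] by the definition of [kgen].  Such costs form a null
      set ([lebesgue_null_low_rank_slack]), the exceptional set.

    So for every cost outside a null set, a block of rank at least [kgen c] has
    a positive semidefinite slack and is never flagged ([not_flagged]).  The
    bound on the number of updates is then arithmetic on the truncated
    progression followed by each block.  At a terminal stage no slack block has
    a negative eigenvalue, so all of them are positive semidefinite by the
    extremal characterization of the least eigenvalue
    ([no_neg_eigenvalue_psd]), and weak duality gives optimality
    ([kkt_optimal]).

    Nullity comes from a covering estimate: the exceptional set is a finite
    union of images of locally Lipschitz maps whose parameters are fewer than
    the coordinates of a cost, and a count of grid cells shows that such
    images are null ([lebesgue_null_loclip_image]). *)

(** * Frobenius inner product and positive semidefinite matrices *)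

Section PSD.
Context {R : realType}.

Lemma innerC m n (X Y : 'M[R]_(m, n)) : inner X Y = inner Y X.
Proof. by rewrite /inner -mxtrace_tr trmx_mul trmxK. Qed.

Lemma innerBr m n (X Y Z : 'M[R]_(m, n)) :
  inner X (Y - Z) = inner X Y - inner X Z.
Proof. exact: linearB. Qed.

Lemma innerDr m n (X Y Z : 'M[R]_(m, n)) :
  inner X (Y + Z) = inner X Y + inner X Z.
Proof. exact: linearD. Qed.

Lemma innerZr m n a (X Y : 'M[R]_(m, n)) : inner X (a *: Y) = a * inner X Y.
Proof. exact: linearZ. Qed.

Lemma innerBl m n (X Y Z : 'M[R]_(m, n)) :
  inner (Y - Z) X = inner Y X - inner Z X.
Proof. by rewrite !(innerC _ X) innerBr. Qed.

Lemma innerDl m n (X Y Z : 'M[R]_(m, n)) :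
  inner (Y + Z) X = inner Y X + inner Z X.
Proof. by rewrite !(innerC _ X) innerDr. Qed.

Lemma innerZl m n a (X Y : 'M[R]_(m, n)) : inner (a *: Y) X = a * inner Y X.
Proof. by rewrite !(innerC _ X) innerZr. Qed.

Lemma inner_adjoint m n p (M : 'M[R]_(m, n)) (X : 'M[R]_(n, p))
    (Y : 'M[R]_(m, p)) :
  inner (M *m X) Y = inner X (M^T *m Y).
Proof. by rewrite /inner trmx_mul mulmxA. Qed.

Lemma inner_trmx m n (X Y : 'M[R]_(m, n)) : inner X^T Y^T = inner X Y.
Proof. by rewrite /inner -mxtrace_tr !trmx_mul !trmxK mxtrace_mulC. Qed.

Lemma inner_ge0 m n (X : 'M[R]_(m, n)) : 0 <= inner X X.
Proof. by rewrite innerE; do 2!apply: sumr_ge0 => ? _; exact: sqr_ge0. Qed.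

Lemma inner_eq0 m n (X : 'M[R]_(m, n)) : (inner X X == 0) = (X == 0).
Proof.
apply/idP/eqP => [|->]; last by rewrite linear0.
rewrite innerE psumr_eq0 => [|i _]; last first.
  by apply: sumr_ge0 => j _; exact: sqr_ge0.
move=> /allP X0; apply/matrixP => i j; rewrite mxE.
move: (X0 i (mem_index_enum i)).
rewrite psumr_eq0 => [/allP/(_ j (mem_index_enum j))|? _].
  by rewrite mulf_eq0 orbb => /eqP.
exact: sqr_ge0.
Qed.

Lemma psd_gram n k (F : 'M[R]_(n, k)) : psd (F *m F^T).
Proof. by move=> x; rewrite -mulmxA innerC inner_adjoint inner_ge0. Qed.

(** Moving from [x] a short way along [- S *m x] would make the form negative
    if [S *m x] were nonzero, because the first-order term dominates. *)
Lemma psd_isotropic n (S : 'M[R]_n) (x : 'cV[R]_n) :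
  S^T = S -> psd S -> inner x (S *m x) = 0 -> S *m x = 0.
Proof.
move=> symS psdS Sx0; set w := S *m x.
apply/eqP; rewrite -inner_eq0; set a := inner w w.
have a_ge0 : 0 <= a by exact: inner_ge0.
rewrite eq_le a_ge0 andbT leNgt; apply/negP => a_gt0.
set c := inner w (S *m w); have c_ge0 : 0 <= c by exact: psdS.
(* The quadratic [t * (t * c - 2 * a)] is negative as soon as [t * c < 2 * a];
   the added 1 keeps the denominator positive. *)
pose t := a / (c + 1).
have c1 : 0 < c + 1 by rewrite ltr_wpDl.
have := psdS (x - t *: w).
have -> : inner (x - t *: w) (S *m (x - t *: w)) = t * (t * c - a *+ 2).
  rewrite mulmxBr -scalemxAr innerBr !innerBl innerZr innerZl Sx0 -/w innerZr.
  by rewrite innerZl -[S in inner x (S *m w)]symS -inner_adjoint -/w -/c; ring.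
apply/negP; rewrite -ltNge pmulr_rlt0 ?divr_gt0 // subr_lt0 /t.
rewrite (@le_lt_trans _ _ a) //; last by rewrite mulr2n ltrDl.
by rewrite mulrAC ler_pdivrMr // ler_wpM2l // lerDl.
Qed.

Lemma psd_no_neg_eigenvalue n (S : 'M[R]_n) : psd S -> ~ has_neg_eigenvalue S.
Proof.
move=> psdS [a a0 /eigenvalueP[v vS v0]].
have := psdS v^T; rewrite innerC inner_adjoint -trmx_mul vS linearZ /= innerZr.
apply/negP; rewrite -ltNge nmulr_rlt0 // lt_def inner_ge0 andbT inner_eq0.
by rewrite trmx_eq0.
Qed.

End PSD.

Section Spectral.
Context {R : realType}.

Lemma continuous_sumr (T : topologicalType) (I : finType) (f : I -> T -> R) :
  (forall i, continuous (f i)) -> continuous (fun x => \sum_i f i x).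
Proof.
move=> cf; have -> : (fun x => \sum_i f i x) = \sum_i f i.
  by apply/funext => x; rewrite fct_sumE.
elim/big_ind: _ => // [x|f1 f2 c1 c2 x]; first exact: cvg_cst.
by apply: cvgD; [exact: c1|exact: c2].
Qed.

Lemma continuous_mulr (T : topologicalType) (f g : T -> R) :
  continuous f -> continuous g -> continuous (fun x => f x * g x).
Proof. by move=> cf cg x; apply: cvgM; [exact: cf|exact: cg]. Qed.

Lemma continuous_quad n (S : 'M[R]_n) :
  continuous (fun v : 'rV[R]_n => inner v (v *m S)).
Proof.
have -> : (fun v : 'rV[R]_n => inner v (v *m S)) =
    (fun v => \sum_j (v ord0 j * \sum_i v ord0 i * S i j)).
  apply/funext => v; rewrite innerE big_ord1.
  by apply: eq_bigr => j _; rewrite !mxE.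
apply: continuous_sumr => j; apply: continuous_mulr.
  exact: coord_continuous.
apply: continuous_sumr => i; apply: continuous_mulr.
  exact: coord_continuous.
exact: cst_continuous.
Qed.

Lemma unit_sphere_compact n : compact [set v : 'rV[R]_n | inner v v = 1].
Proof.
apply: (@subclosed_compact _ _
    [set v : 'rV[R]_n | forall i, v ord0 i \in `[(- 1 : R), 1]]).
- have -> : [set v : 'rV[R]_n | inner v v = 1] =
      (fun v => inner v (v *m 1%:M)) @^-1` [set x | x = 1].
    by apply/seteqP; split => v /=; rewrite mulmx1.
  by have /continuous_closedP := @continuous_quad n 1%:M; apply; exact: closed_eq.
- apply: (@rV_compact _  _ (fun=> `[(- 1 : R), 1]%classic)).
  by move=> _; exact: segment_compact.
- move=> v /= v1 i.
  have : v ord0 i ^+ 2 <= 1.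
    rewrite -v1 innerE big_ord1 (bigD1 i) //= lerDl.
    by apply: sumr_ge0 => j _; exact: sqr_ge0.
  by move=> vi; rewrite in_itv /=; apply/andP; split; nra.
Qed.

(** The quadratic form attains its minimum [a] over the compact unit sphere at
    some [c].  Then [S - a] is positive semidefinite and vanishes on [c], so [c]
    is an eigenvector for [a]; if the form took a negative value, [a] would be
    a negative eigenvalue. *)
Lemma no_neg_eigenvalue_psd n (S : 'M[R]_n) :
  S^T = S -> ~ has_neg_eigenvalue S -> psd S.
Proof.
move=> symS noev.
have qE (x : 'cV[R]_n) : inner x (S *m x) = inner x^T (x^T *m S).
  by rewrite -[in RHS]symS -trmx_mul inner_trmx.
move=> x; rewrite leNgt; apply/negP => x_lt0.
have unit_scale (v : 'rV[R]_n) : v != 0 -> exists2 w : 'rV[R]_n,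
    inner w w = 1 & inner v (v *m S) = inner v v * inner w (w *m S).
  move=> v0; have s_gt0 : 0 < inner v v by rewrite lt_def inner_eq0 v0 inner_ge0.
  exists ((Num.sqrt (inner v v))^-1 *: v).
    by rewrite innerZl innerZr mulrA -expr2 exprVn sqr_sqrtr ?mulVf ?gt_eqF ?ltW.
  rewrite -scalemxAl innerZl innerZr [X in _ = _ * X]mulrA -expr2 exprVn.
  by rewrite sqr_sqrtr ?ltW // mulrA divff ?mul1r // gt_eqF.
have x0 : x^T != 0.
  by apply/eqP => x0; move: x_lt0; rewrite qE x0 mul0mx linear0 ltxx.
have [w w1 xw] := unit_scale _ x0.
have [||c] := @compact_EVT_min _ R (fun v : 'rV[R]_n => inner v (v *m S))
  _ _ (@unit_sphere_compact n).
- by exists w.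
- by apply: continuous_subspaceT; exact: continuous_quad.
rewrite inE /= => c1 minc.
have cS_lt0 : inner c (c *m S) < 0.
  apply: (le_lt_trans (minc w _)); first by rewrite inE.
  move: x_lt0; rewrite qE xw pmulr_rlt0 // lt_def inner_ge0 andbT inner_eq0.
  exact: x0.
apply: noev; exists (inner c (c *m S)) => //; apply/eigenvalueP; exists c.
  set a := inner c (c *m S).
  have shift (v : 'cV[R]_n) : (S - a%:M) *m v = S *m v - a *: v.
    by rewrite mulmxBl mul_scalar_mx.
  have /eqP : (S - a%:M) *m c^T = 0.
    apply: psd_isotropic => [|v|].
    - by rewrite linearB /= tr_scalar_mx symS.
    - rewrite shift innerBr innerZr subr_ge0 qE.
      have [->|v0] := eqVneq v 0; first by rewrite trmx0 mul0mx !linear0 mulr0.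
      have [|u u1 ->] := unit_scale v^T; first by rewrite trmx_eq0.
      rewrite inner_trmx mulrC ler_wpM2l ?inner_ge0 //.
      by apply: minc; rewrite inE.
    - by rewrite shift innerBr innerZr qE inner_trmx trmxK c1 mulr1 subrr.
  rewrite shift subr_eq0 => /eqP /(congr1 trmx).
  by rewrite trmx_mul symS linearZ /= trmxK.
by rewrite -inner_eq0 c1 oner_eq0.
Qed.

Lemma inner_delta n (i : 'I_n) (v : 'cV[R]_n) :
  inner (delta_mx i ord0) v = v i ord0.
Proof. by rewrite /inner trmx_delta -rowE /mxtrace big_ord1 mxE. Qed.

Lemma psd_diag n (X : 'M[R]_n) (i : 'I_n) : psd X -> 0 <= X i i.
Proof. by move=> /(_ (delta_mx i ord0)); rewrite inner_delta -colE mxE. Qed.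

Lemma psd_diag_eq0 n (X : 'M[R]_n) (i : 'I_n) :
  X^T = X -> psd X -> X i i = 0 -> col i X = 0.
Proof.
move=> symX psdX Xi0; rewrite colE; apply: psd_isotropic => //.
by rewrite inner_delta -colE mxE.
Qed.

(** The new form at [y] is the old one at [y - a e_i], where [a] minimizes
    the old form along the direction [e_i]. *)
Lemma psd_schur n (X : 'M[R]_n) (i : 'I_n) : X^T = X -> psd X -> X i i != 0 ->
  psd (X - (X i i)^-1 *: (col i X *m (col i X)^T)).
Proof.
move=> symX psdX d0 y.
pose e : 'cV[R]_n := delta_mx i ord0; pose a := inner (col i X) y / X i i.
have eXy : inner e (X *m y) = inner (col i X) y.
  by rewrite -{1}symX -inner_adjoint -colE.
have := psdX (y - a *: e).
rewrite mulmxBr -scalemxAr -colE innerBl !innerBr !innerZl !innerZr eXy.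
rewrite inner_delta mulmxBl innerBr -scalemxAl innerZr -mulmxA.
rewrite [inner y (col i X *m _)]innerC inner_adjoint.
have -> : inner ((col i X)^T *m y) ((col i X)^T *m y) = inner (col i X) y ^+ 2.
  rewrite [inner (col i X) y]/inner; set z := _ *m y.
  by rewrite innerE /mxtrace !big_ord1.
rewrite [inner y (col i X)]innerC mxE /a.
suff -> : forall p q d : R, d != 0 ->
  p - q / d * q - (q / d * q - q / d * (q / d * d)) = p - d^-1 * q ^+ 2 by [].
by move=> p q d dn0; field.
Qed.

(** Removing the rank-one part of [psd_schur] clears a diagonal entry and keeps
    the vanishing ones at zero, so finitely many steps write [X] as a sum of
    nonnegative multiples of [u u^T], on each of which the trace is a value of
    the quadratic form of [S]. *)
Lemma psd_trace_ge0 n (S X : 'M[R]_n) :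
  psd S -> X^T = X -> psd X -> 0 <= \tr (S *m X).
Proof.
move=> psdS; have [k] := ubnP #|[pred i : 'I_n | X i i != 0]|.
elim: k X => // k IH X; rewrite ltnS => cardX symX psdX.
have [i /= Xi|X0] := pickP [pred i | X i i != 0]; last first.
  suff -> : X = 0 by rewrite mulmx0 mxtrace0.
  apply/matrixP => i j; rewrite [RHS]mxE.
  have /(congr1 (fun v : 'cV[R]_n => v i ord0)) : col j X = 0.
    by apply: psd_diag_eq0 => //; have /negbFE/eqP := X0 j.
  by rewrite !mxE.
set u := col i X; pose Y := (X i i)^-1 *: (u *m u^T).
have -> : X = (X - Y) + Y by rewrite subrK.
rewrite mulmxDr linearD /= addr_ge0 //.
  apply: IH; last exact: psd_schur.
    apply: leq_trans cardX; apply: proper_card; apply/properP; split.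
      apply/fintype.subsetP => j; rewrite !inE; apply: contra => /eqP Xj.
      have /(congr1 (fun v : 'cV[R]_n => v i ord0)) := psd_diag_eq0 symX psdX Xj.
      rewrite !mxE => Xij; have Xji : X j i = 0 by rewrite -symX mxE.
      by rewrite big_ord1 !mxE Xj Xji !mulr0 subr0.
    exists i; rewrite !inE //= !mxE big_ord1 !mxE.
    by rewrite mulrA mulVf // mul1r subrr eqxx.
  by rewrite linearB linearZ /= trmx_mul trmxK symX.
rewrite -scalemxAr linearZ /= mulr_ge0 ?invr_ge0 ?psd_diag //.
by rewrite mulmxA mxtrace_mulC; exact: psdS.
Qed.

End Spectral.

(** * Derivatives along lines *)

Section Calculus.
Context {R : realType}.

(** The augmented Lagrangian and its first derivatives are polynomial along
    every line, so each directional derivative is the linear coefficient of an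
    explicit polynomial. *)
Lemma derive_Poly N (f : 'rV[R]_N -> R^o) (a v : 'rV[R]_N) (s : seq R) :
  (forall h : R, f (h *: v + a) = (Poly s).[h]) -> 'D_v f a = s`_1.
Proof.
move=> fs; have fa : f a = (Poly s).[0] by rewrite -fs scale0r add0r.
transitivity ('D_1 (horner (Poly s) : R -> R^o) 0); last first.
  rewrite (@derive_val _ _ _ _ _ _ _ (is_derive_poly (Poly s) 0)).
  by rewrite horner_coef0 coef_deriv coef_Poly.
rewrite /derive fa; apply: (congr1 (fun g : R -> R^o => lim (g @ 0^'))).
apply/funext => h /=.
by rewrite fs addr0 [h *: 1]mulr1.
Qed.

Lemma linear_row_sum N (f : 'rV[R]_N -> R) :
  (forall a u v, f (a *: u + v) = a * f u + f v) ->
  forall u, f u = \sum_j u ord0 j * f (delta_mx ord0 j).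
Proof.
move=> linf u; have f0 : f 0 = 0.
  have /esym := linf 1 0 0.
  by rewrite scale1r addr0 mul1r -[RHS]addr0 => /addrI.
rewrite {1}[u]row_sum_delta (big_morph f (id1 := 0) (op1 := +%R)) //.
  by apply: eq_bigr => j _; rewrite -[X in f X]addr0 linf f0 addr0.
by move=> x y; rewrite -[x]scale1r linf mul1r scale1r.
Qed.

Lemma quad_bilinear N (B : 'rV[R]_N -> 'rV[R]_N -> R) (x : 'cV[R]_N) :
  (forall w a u v, B w (a *: u + v) = a * B w u + B w v) ->
  (forall u a w v, B (a *: w + v) u = a * B w u + B v u) ->
  inner x ((\matrix_(i, j) B (delta_mx ord0 i) (delta_mx ord0 j)) *m x) =
    B x^T x^T.
Proof.
move=> linr linl; rewrite (linear_row_sum (linl x^T)) innerE.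
apply: eq_bigr => i _; rewrite big_ord1 !mxE; congr (_ * _).
rewrite (linear_row_sum (linr _)); apply: eq_bigr => j _.
by rewrite !mxE mulrC.
Qed.

End Calculus.

(** * Second-order stationary points of the augmented Lagrangian *)

Section AugmentedLagrangian.
Context {R : realType} {q m : nat} {n : 'I_q -> nat}.
Variables (b : 'cV[R]_m) (A : forall c, 'Hom(symmx R (n c), 'cV[R]_m)).
Variables (C : cost R n) (rho : R) (y : 'cV[R]_m) (k : 'I_q -> nat).
Local Notation factor := 'rV[R]_(\sum_c n c * k c)%N.
Implicit Types F U W : factor.

Lemma gram_expand p r (F U : 'M[R]_(p, r)) h :
  gram (h *: U + F) = h ^+ 2 *: gram U + (h *: dgram F U + gram F).
Proof.
apply: val_inj => /=; rewrite [(_ + _)^T]linearP /= mulmxDl !mulmxDr.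
rewrite -!scalemxAl -!scalemxAr scalerA -expr2 [h *: (_ + _)]scalerDr -!addrA.
by congr (_ + _); rewrite addrCA; congr (_ + _).
Qed.

Lemma constr_expand F U h :
  constr b A (h *: U + F) =
    h ^+ 2 *: (\sum_c A c (gram (block U c))) + (h *: Dconstr A F U + constr b A F).
Proof.
rewrite /constr /Dconstr !scaler_sumr !addrA -!big_split /=; congr (_ - _).
by apply: eq_bigr => c _; rewrite block_linear gram_expand !linearP addrA.
Qed.

(** The derivative of the map sending [F] to [sdp_value S (grams F)], at [F]
    along [U]. *)
Definition pairing (S : cost R n) F U : R :=
  \sum_c inner (vsval (S c)) (vsval (dgram (block F c) (block U c))).

Lemma dgramC p r (F U : 'M[R]_(p, r)) : dgram F U = dgram U F.
Proof. by apply: val_inj => /=; rewrite addrC. Qed.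

Lemma dgram_linear p r (F U V : 'M[R]_(p, r)) a :
  dgram F (a *: U + V) = a *: dgram F U + dgram F V.
Proof.
apply: val_inj => /=; rewrite linearP /= mulmxDr mulmxDl -scalemxAr -scalemxAl.
by rewrite scalerDr addrACA.
Qed.

Lemma pairingC S F U : pairing S F U = pairing S U F.
Proof. by apply: eq_bigr => c _; rewrite dgramC. Qed.

Lemma pairing_linear S F U V a :
  pairing S F (a *: U + V) = a * pairing S F U + pairing S F V.
Proof.
rewrite /pairing mulr_sumr -big_split; apply: eq_bigr => c _.
by rewrite block_linear dgram_linear linearP.
Qed.

Lemma DconstrC F U : Dconstr A F U = Dconstr A U F.
Proof. by apply: eq_bigr => c _; rewrite dgramC. Qed.

Lemma sdp_value_expand F U h :
  sdp_value C (grams (h *: U + F)) =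
    h ^+ 2 * sdp_value C (grams U) + (h * pairing C F U + sdp_value C (grams F)).
Proof.
rewrite /sdp_value /pairing !mulr_sumr -!big_split; apply: eq_bigr => c _.
by rewrite /grams block_linear gram_expand !linearP.
Qed.

Lemma inner_slack c (X : symmx R (n c)) :
  inner (vsval (slack A C y c)) (vsval X) =
    inner (vsval (C c)) (vsval X) - inner y (A c X).
Proof. by rewrite -adjP -innerBl. Qed.

Lemma pairing_slack F U :
  pairing (slack A C y) F U = pairing C F U - inner y (Dconstr A F U).
Proof.
rewrite /Dconstr [inner y _](linear_sum (inner y)) -sumrB.
by apply: eq_bigr => c _; exact: inner_slack.
Qed.

Lemma derive_Phi F U : 'D_U (Phi b A C rho y (k := k)) F =
  pairing (slack A C y) F U + rho * inner (constr b A F) (Dconstr A F U).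
Proof.
set G := \sum_c A c (gram (block U c)); set D := Dconstr A F U.
set c0 := constr b A F; set V := fun F => sdp_value C (grams F).
rewrite (@derive_Poly _ _ _ _ _ [:: Phi b A C rho y F;
  pairing C F U - inner y D + rho * inner c0 D;
  V U - inner y G + rho / 2 * (inner D D + 2 * inner c0 G);
  rho * inner D G; rho / 2 * inner G G]); first by rewrite pairing_slack.
move=> h; rewrite horner_Poly /= /Phi constr_expand sdp_value_expand -/G -/D -/c0.
rewrite -/(V F) -/(V U); clearbody G D c0 V.
rewrite !innerDr !innerDl !innerZr !innerZl ?(innerC D c0) ?(innerC G c0).
rewrite ?(innerC G D); by field.
Qed.

Lemma derive2_Phi F U W :
  'D_W ('D_U (Phi b A C rho y (k := k))) F =
    pairing (slack A C y) W U + rho * (inner (Dconstr A F W) (Dconstr A F U) +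
      inner (constr b A F) (Dconstr A W U)).
Proof.
have -> : 'D_U (Phi b A C rho y (k := k)) = fun F =>
  pairing (slack A C y) F U + rho * inner (constr b A F) (Dconstr A F U).
  by apply/funext => G; exact: derive_Phi.
set G := \sum_c A c (gram (block W c)); set D := Dconstr A F W.
set c0 := constr b A F; set D' := Dconstr A F U; set D2 := Dconstr A W U.
rewrite (@derive_Poly _ _ _ _ _ [:: pairing (slack A C y) F U + rho * inner c0 D';
  pairing (slack A C y) W U + rho * (inner D D' + inner c0 D2);
  rho * (inner G D' + inner D D2); rho * inner G D2]) //.
move=> h; rewrite horner_Poly /= constr_expand -/G -/D -/c0.
rewrite [pairing _ (_ + _) _]pairingC pairing_linear !(pairingC _ U).
rewrite [Dconstr _ (_ + _) _]DconstrC linearP /= !(DconstrC U) -/D' -/D2.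
clearbody G D c0 D' D2.
rewrite !innerDr !innerDl !innerZr !innerZl; by ring.
Qed.

Lemma block_surj (X : forall c, 'M[R]_(n c, k c)) :
  exists U : factor, forall c, block U c = X c.
Proof.
exists (\mxrow_c mxvec (X c)) => c.
by rewrite /block mxrowK mxvecK.
Qed.

Lemma inner_dgram p r (S : symmx R p) (F U : 'M[R]_(p, r)) :
  inner (vsval S) (vsval (dgram F U)) = 2 * inner (vsval S *m F) U.
Proof.
have /symvP symS := valP S; rewrite /= innerDr.
have -> : inner (vsval S) (F *m U^T) = inner (vsval S) (U *m F^T).
  by rewrite -inner_trmx symS trmx_mul trmxK.
rewrite -mulr2n -[LHS]mulr_natl /inner trmx_mul symS mulmxA mxtrace_mulC.
by rewrite mulmxA.
Qed.

(** The derivative along [U] is twice the sum over the blocks of the inner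
    product of [S c *m F c] with [U c]; it is tested on [U c = S c *m F c]. *)
Lemma sosp_stationary F : feasible_sosp b A C rho y F ->
  forall c, vsval (slack A C y c) *m block F c = 0.
Proof.
case=> cF gradF _; pose f U := pairing (slack A C y) F U.
have f0 U : f U = 0.
  have linf a V W : f (a *: V + W) = a * f V + f W by exact: pairing_linear.
  rewrite (linear_row_sum linf) big1 // => j _.
  have := congr1 (fun g : 'rV[R]_(\sum_c n c * k c) => g ord0 j) gradF.
  rewrite !mxE derive_Phi cF [inner 0 _]innerC linear0 mulr0 addr0 => fj.
  by rewrite /f fj mulr0.
have [U blockU] := block_surj (fun c => vsval (slack A C y c) *m block F c).
have : \sum_c 2 * inner (vsval (slack A C y c) *m block F c)
    (vsval (slack A C y c) *m block F c) = 0.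
  rewrite -[RHS](f0 U) /f /pairing; apply: eq_bigr => c _.
  by rewrite inner_dgram blockU.
move=> /eqP; rewrite psumr_eq0 => [/allP SF0 c|c _]; last first.
  by rewrite mulr_ge0 ?inner_ge0.
apply/eqP; rewrite -inner_eq0; have := SF0 c (mem_index_enum c).
by rewrite /= mulf_eq0 pnatr_eq0.
Qed.

Lemma sosp_curvature F : feasible_sosp b A C rho y F -> forall U,
  0 <= pairing (slack A C y) U U +
       rho * inner (Dconstr A F U) (Dconstr A F U).
Proof.
case=> cF _ hessF U.
pose B W V := pairing (slack A C y) W V +
  rho * inner (Dconstr A F W) (Dconstr A F V).
have := hessF U^T; have -> : hess (Phi b A C rho y (k := k)) F =
    \matrix_(i, j) B (delta_mx ord0 i) (delta_mx ord0 j).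
  apply/matrixP => i j; rewrite !mxE derive2_Phi cF [inner 0 _]innerC linear0.
  by rewrite addr0.
rewrite quad_bilinear ?trmxK // /B => [W a V X|V a W X].
  by rewrite pairing_linear linearP innerDr innerZr; ring.
rewrite ![pairing _ _ V]pairingC pairing_linear linearP innerDl innerZl.
by rewrite !(pairingC _ V); ring.
Qed.

(** With [block F c *m z = 0], the direction [x *m z^T] supported in block
    [c] is annihilated by the derivative of the constraint, so the penalty term
    drops out of the curvature and what is left is a positive multiple of the
    value at [x] of the quadratic form of the slack. *)
Lemma rank_deficient_psd F c : feasible_sosp b A C rho y F ->
  (\rank (block F c) < k c)%N -> psd (vsval (slack A C y c)).
Proof.
move=> sosp rankF x.
have [z z0 Fz] : exists2 z : 'cV[R]_(k c), z != 0 & block F c *m z = 0.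
  have : kermx (block F c)^T != 0.
    by rewrite kermx_eq0 /row_free mxrank_tr ltn_eqF.
  move=> /rowV0Pn[z /sub_kermxP zF z0]; exists z^T; first by rewrite trmx_eq0.
  by rewrite -[block F c]trmxK -trmx_mul zF trmx0.
(* The cast only transports [x *m z^T] from block [c] to the equal block [d]. *)
pose X d : 'M[R]_(n d, k d) :=
  if c =P d is ReflectT cd then
    castmx (congr1 n cd, congr1 k cd) (x *m z^T) else 0.
have [U blockU] := block_surj X.
have blockUc : block U c = x *m z^T.
  by rewrite blockU /X; case: eqP => // cc; rewrite (eq_irrelevance cc erefl).
have blockUd d : c != d -> block U d = 0.
  by rewrite blockU /X; case: eqP.
have dgram0 p r (V W : 'M[R]_(p, r)) : V *m W^T = 0 -> dgram V W = 0.
  move=> VW; apply: val_inj => /=.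
  by rewrite -[W *m V^T]trmxK trmx_mul trmxK VW trmx0 addr0.
have := sosp_curvature sosp U.
have -> : Dconstr A F U = 0.
  rewrite /Dconstr big1 // => d _; have [<-|cd] := eqVneq c d.
    by rewrite dgram0 ?linear0 // blockUc trmx_mul trmxK mulmxA Fz mul0mx.
  by rewrite dgram0 ?linear0 // blockUd // trmx0 mulmx0.
rewrite linear0 mulr0 addr0 /pairing (bigD1 c) // big1 => [|d dc]; last first.
  by rewrite inner_dgram blockUd 1?eq_sym // linear0 mulr0.
rewrite [X in 0 <= X]addr0 inner_dgram blockUc pmulr_rge0 ?ltr0n // /inner trmx_mul.
have /symvP -> := valP (slack A C y c).
rewrite mulmxA mxtrace_mulC trmx_mul trmxK -!mulmxA.
rewrite [z^T *m _]mulmxA [z^T *m z]mx11_scalar.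
rewrite mul_scalar_mx mxtraceZ.
have -> : (z^T *m z) ord0 ord0 = inner z z by rewrite /inner /mxtrace big_ord1.
by rewrite pmulr_rge0 // lt_def inner_ge0 andbT inner_eq0.
Qed.

End AugmentedLagrangian.

(** * Lebesgue null sets of product costs *)

Section NullSets.
Context {R : realType} {q : nat} (n : 'I_q -> nat).
Implicit Types (E : set (cost R n)) (l u : cost R n).

Lemma box_volume_ge0 l u :
  (forall c i j, entry (l c) i j <= entry (u c) i j) -> 0 <= box_volume l u.
Proof. by move=> lu; do 3!apply: prodr_ge0 => ? _; rewrite subr_ge0. Qed.

Lemma sub_lebesgue_null E1 E2 :
  E1 `<=` E2 -> lebesgue_null E2 -> lebesgue_null E1.
Proof.
move=> E12 null2 e e0; have [l [u [lu cov vol]]] := null2 e e0.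
by exists l, u; split => // x /E12/cov.
Qed.

Lemma lebesgue_null_bigcup (E : nat -> set (cost R n)) :
  (forall i, lebesgue_null (E i)) -> lebesgue_null (\bigcup_i E i).
Proof.
move=> nullE e e0.
have en i : 0 < e / (2 ^ i.+1)%:R by rewrite divr_gt0 // ltr0n expn_gt0.
have [l /choice[u lu]] := choice (fun i => nullE i _ (en i)).
have /ppcard_eqP[{}f] := card_esym card_nat2.
exists (fun t => l (f t).1 (f t).2), (fun t => u (f t).1 (f t).2); split.
- by move=> t c i j; have [+ _ _] := lu (f t).1; apply.
- move=> C [i _ EC]; have [_ cov _] := lu i; have [j _ bC] := cov C EC.
  by exists (f^-1%FUN (i, j)) => //=; rewrite invK ?inE.
pose v (p : nat * nat) := (box_volume (l p.1 p.2) (u p.1 p.2))%:E.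
have v0 p : (0 <= v p)%E.
  by rewrite lee_fin box_volume_ge0 // => *; have [+ _ _] := lu p.1; apply.
rewrite -[X in (X <= _)%E]/(\sum_(0 <= t <oo) v (f t))%E nneseries_esumT //.
rewrite -(@reindex_esum _ _ _ setT setT f v); last exact: bij.
have -> : \esum_(p in setT) v p = (\esum_(i in setT) \esum_(j in setT) v (i, j))%E.
  by rewrite esum_esum //; congr esum; apply/seteqP; split.
rewrite -nneseries_esumT => [|i]; last exact: esum_ge0.
apply: le_trans (epsilon_trick0 xpredT (ltW e0)).
apply: lee_nneseries => [i _ _|i _]; first exact: esum_ge0.
by rewrite -nneseries_esumT //; have [_ _] := lu i.
Qed.

(** A finite cover is completed to a sequence by copies of a degenerate box
    of volume 0.  Such a box exists exactly when the cost space is not a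
    point. *)
Lemma lebesgue_null_finite_cover E : 
  (forall e : R, 0 < e -> exists (I : finType) (l u : I -> cost R n),
    [/\ forall t c i j, entry (l t c) i j <= entry (u t c) i j,
        forall C, E C -> exists t, box (l t) (u t) C,
        exists d : cost R n, box_volume d d = 0 &
        \sum_t box_volume (l t) (u t) <= e]) ->
  lebesgue_null E.
Proof.
move=> covE e e0; have [I [l [u [lu cov [d d0] vol]]]] := covE e e0.
pose ext (w : I -> cost R n) t :=
  if insub t is Some s then w (enum_val (s : 'I_#|I|)) else d.
exists (ext l), (ext u); split.
- by move=> t c i j; rewrite /ext; case: insub.
- move=> C /cov[t Ct]; exists (val (enum_rank t)) => //.
  by rewrite /ext valK enum_rankK.
have vol_ge0 t : 0 <= box_volume (ext l t) (ext u t).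
  by rewrite /ext; case: insub => [s|]; rewrite ?d0 // box_volume_ge0.
rewrite (@nneseries_split _ _ 0 #|I|) => [|k _]; last by rewrite lee_fin.
rewrite add0n [X in (_ + X)%E]eseries0 => [|i Ii _]; last first.
  by rewrite /ext insubN ?d0 // -leqNgt.
rewrite adde0 big_mkord sumEFin lee_fin; apply: le_trans vol.
rewrite (reindex (@enum_val I predT)) /=; last first.
  by exists enum_rank => x _; rewrite ?enum_valK ?enum_rankK.
by apply: ler_sum => s _; rewrite /ext valK.
Qed.

Definition entry_ix := {c : 'I_q & ('I_(n c) * 'I_(n c))%type}.
(** One index for each free entry of a symmetric block, so that [#|upper|] is
    the dimension of the cost space. *)
Definition upper : pred entry_ix := fun t => ((tagged t).1 <= (tagged t).2)%N.

Lemma box_volume_cst l u h :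
  (forall c i j, entry (u c) i j - entry (l c) i j = h) ->
  box_volume l u = h ^+ #|upper|.
Proof.
move=> luh; rewrite -prodr_const /box_volume.
transitivity (\prod_(c < q) \prod_(p : 'I_(n c) * 'I_(n c) | (p.1 <= p.2)%N) h).
  apply: eq_bigr => c _; rewrite pair_big_dep; apply: eq_bigr => p _.
  exact: luh.
by rewrite sig_big_dep; apply: eq_bigl => t.
Qed.

End NullSets.

Section LocallyLipschitz.
Context {R : realType} {Q : finType}.
Implicit Types f g : (Q -> R) -> R.

(** Lipschitz on every cube for the supremum distance; [d] bounds that
    distance, which avoids a norm on [Q -> R]. *)
Definition loclip f := forall M : nat, exists2 L : R, 0 <= L &
  forall (x y : Q -> R) (d : R), 0 <= d ->
    (forall i, `|x i| <= M%:R) -> (forall i, `|y i| <= M%:R) ->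
    (forall i, `|x i - y i| <= d) -> `|f x - f y| <= L * d.

Lemma loclip_cst (a : R) : loclip (fun=> a).
Proof. by move=> M; exists 0 => // x y d *; rewrite subrr normr0 mul0r. Qed.

Lemma loclip_coord (i : Q) : loclip (fun x => x i).
Proof. by move=> M; exists 1 => // x y d *; rewrite mul1r. Qed.

Lemma loclip_bounded f M : loclip f -> exists2 B : R, 0 <= B &
  forall x, (forall i, `|x i| <= M%:R) -> `|f x| <= B.
Proof.
move=> /(_ M)[L L0 fL]; exists (`|f (fun=> 0)| + L * M%:R).
  by rewrite addr_ge0 // mulr_ge0.
move=> x xM; rewrite -[f x](addrNK (f (fun=> 0))) [_ + L * _]addrC.
rewrite (le_trans (ler_normD _ _)) // lerD2r fL // => i; first by rewrite normr0.
by rewrite subr0.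
Qed.

Lemma loclipD f g : loclip f -> loclip g -> loclip (fun x => f x + g x).
Proof.
move=> lf lg M; have [L L0 fL] := lf M; have [K K0 gK] := lg M.
exists (L + K) => [|x y d d0 xM yM xyd]; first exact: addr_ge0.
have -> : f x + g x - (f y + g y) = (f x - f y) + (g x - g y) by ring.
by rewrite mulrDl (le_trans (ler_normD _ _)) // lerD ?fL ?gK.
Qed.

Lemma loclipM f g : loclip f -> loclip g -> loclip (fun x => f x * g x).
Proof.
move=> lf lg M; have [L L0 fL] := lf M; have [K K0 gK] := lg M.
have [B B0 fB] := loclip_bounded M lf; have [C C0 gC] := loclip_bounded M lg.
exists (B * K + L * C) => [|x y d d0 xM yM xyd].
  by rewrite addr_ge0 // mulr_ge0.
have -> : f x * g x - f y * g y = f x * (g x - g y) + (f x - f y) * g y by ring.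
have -> : (B * K + L * C) * d = B * (K * d) + (L * d) * C by ring.
rewrite (le_trans (ler_normD _ _)) // !normrM lerD //.
  by apply: ler_pM => //; [exact: fB|exact: gK].
by apply: ler_pM => //; [exact: fL|exact: gC].
Qed.

Lemma loclip_sum (I : finType) (P : pred I) (f : I -> (Q -> R) -> R) :
  (forall i, P i -> loclip (f i)) -> loclip (fun x => \sum_(i | P i) f i x).
Proof.
move=> lf; suff : loclip (\sum_(i | P i) f i).
  by congr loclip; apply/funext => x; rewrite fct_sumE.
apply: (big_ind loclip) => //; first exact: loclip_cst.
exact: loclipD.
Qed.

End LocallyLipschitz.

Section LipschitzImage.
Context {R : realType} {q : nat} (n : 'I_q -> nat) (Q : finType).

Lemma all_ones_sym k : (const_mx 1 : 'M[R]_k) \in symv R k.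
Proof. by apply/symvP; rewrite trmx_const. Qed.

Lemma entry_shift k (X : symmx R k) (h : R) i j :
  entry (X + h *: Subvs (all_ones_sym k)) i j = entry X i j + h.
Proof. by rewrite /entry linearD linearZ /= !mxE mulr1. Qed.

(** [(2MN).+1 ^ p] boxes of side [2L/N] in dimension [D > p]: the total volume
    is of order [N ^ (p - D)]. *)
Lemma grid_count (M N p D : nat) (L : R) : (0 < N)%N -> (0 < M)%N -> (p < D)%N ->
  0 <= L ->
  ((2 * M * N).+1 ^ p)%:R * (2 * (L / N%:R)) ^+ D <=
    (3 * M)%:R ^+ p * (2 * L) ^+ D / N%:R.
Proof.
move=> N0 M0 pD L0; have N0' : 0 < N%:R :> R by rewrite ltr0n.
have -> : (2 * (L / N%:R)) ^+ D = (2 * L) ^+ D / N%:R ^+ D.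
  by rewrite mulrA expr_div_n.
set K := (2 * L) ^+ D; have K0 : 0 <= K by rewrite exprn_ge0 // mulr_ge0.
have NDE : N%:R ^+ D = N%:R ^+ p * (N%:R * N%:R ^+ (D - p.+1)) :> R.
  by rewrite -exprS -exprD; congr (_ ^+ _); lia.
have countP : ((2 * M * N).+1 ^ p)%:R <= (3 * M)%:R ^+ p * N%:R ^+ p :> R.
  by rewrite -exprMn natrX -natrM lerXn2r ?nnegrE ?ler0n // ler_nat; nia.
apply: (@le_trans _ _ ((3 * M)%:R ^+ p * N%:R ^+ p * (K / N%:R ^+ D))).
  by rewrite ler_wpM2r // divr_ge0 // exprn_ge0.
have -> : (3 * M)%:R ^+ p * N%:R ^+ p * (K / N%:R ^+ D) =
    (3 * M)%:R ^+ p * K / N%:R / N%:R ^+ (D - p.+1).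
  by rewrite NDE; field; rewrite !expf_neq0 // gt_eqF.
rewrite ler_pdivrMr ?exprn_gt0 // ler_peMr ?exprn_ege1 ?ler1n //.
by rewrite divr_ge0 // mulr_ge0 // exprn_ge0.
Qed.

(** Cut the cube of radius [M] of the parameter space into cells of side [1/N].
    Each cell is mapped into a box of side [2L/N], and there are of order
    [N ^ #|Q|] of them, so the total volume tends to 0 with [1/N] when [#|Q|] is
    less than the dimension of the target. *)
Lemma lebesgue_null_loclip_image (g : (Q -> R) -> cost R n) :
  (#|Q| < #|@upper q n|)%N ->
  (forall c i j, loclip (fun x => entry (g x c) i j)) -> lebesgue_null (range g).
Proof.
move=> QD lip.
pose cube M : set (Q -> R) := [set x | forall i, `|x i| <= M.+1%:R].
apply: (@sub_lebesgue_null _ _ _ _ (\bigcup_M (g @` cube M))).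
  move=> _ [x _ <-]; exists (Num.trunc (\sum_i `|x i|)) => //; exists x => // i.
  rewrite (le_trans _ (ltW (truncnS_gt _))) // (bigD1 i) //= lerDl.
  exact: sumr_ge0.
apply: lebesgue_null_bigcup => M; apply: lebesgue_null_finite_cover => e e0.
have [L L0 gL] : exists2 L : R, 0 <= L & forall c i j (x y : Q -> R) (d : R),
    0 <= d -> cube M x -> cube M y -> (forall s, `|x s - y s| <= d) ->
    `|entry (g x c) i j - entry (g y c) i j| <= L * d.
  have /choice[K Kp] (t : entry_ix n) : exists L : R, 0 <= L /\
      forall (x y : Q -> R) (d : R),
      0 <= d -> cube M x -> cube M y -> (forall s, `|x s - y s| <= d) ->
      `|entry (g x (tag t)) (tagged t).1 (tagged t).2 -
        entry (g y (tag t)) (tagged t).1 (tagged t).2| <= L * d.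
    have [L L0 fL] := lip (tag t) (tagged t).1 (tagged t).2 M.+1.
    by exists L; split.
  exists (\sum_t K t) => [|c i j x y d d0 cx cy xyd].
    by apply: sumr_ge0 => t _; have [] := Kp t.
  pose t : entry_ix n := Tagged _ (i, j).
  have [_ /(_ x y d d0 cx cy xyd) /le_trans] := Kp t; apply.
  rewrite ler_wpM2r // (bigD1 t) //= lerDl.
  by apply: sumr_ge0 => s _; have [] := Kp s.
pose D := #|@upper q n|.
pose A := (3 * M.+1)%:R ^+ #|Q| * (2 * L) ^+ D.
pose N := (Num.trunc (A / e)).+1.
have N0 : 0 < N%:R :> R by rewrite ltr0n.
have AN : A / N%:R <= e.
  by rewrite ler_pdivrMr // mulrC -ler_pdivrMr // ltW // truncnS_gt.
pose corner (k : {ffun Q -> 'I_(2 * M.+1 * N).+1}) (s : Q) : R :=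
  (k s)%:R / N%:R - M.+1%:R.
have corner_cube k : cube M (corner k).
  move=> s; rewrite ler_norml /corner lerDr divr_ge0 //= lerBlDr.
  rewrite ler_pdivrMr // -natrD -natrM ler_nat addnn -mul2n.
  by rewrite -ltnS ltn_ord.
pose h := L / N%:R; have h0 : 0 <= h by rewrite divr_ge0.
exists {ffun Q -> 'I_(2 * M.+1 * N).+1},
  (fun k c => g (corner k) c + (- h) *: Subvs (all_ones_sym (n c))),
  (fun k c => g (corner k) c + h *: Subvs (all_ones_sym (n c))); split.
- by move=> k c i j; rewrite !entry_shift lerD2l ge0_cp.
- move=> _ [x cx <-].
  have ltk s : (Num.trunc ((x s + M.+1%:R) * N%:R) < (2 * M.+1 * N).+1)%N.
    rewrite ltnS -(ler_nat R) (le_trans (y := (x s + M.+1%:R) * N%:R)) //.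
      rewrite truncn_le mulr_ge0 // -lerBlDr sub0r.
      by have := cx s; rewrite ler_norml => /andP[].
    rewrite natrM ler_wpM2r // mul2n -addnn natrD lerD2r.
    by have := cx s; rewrite ler_norml => /andP[].
  exists [ffun s => Ordinal (ltk s)] => c i j; set k := finfun _.
  rewrite !entry_shift -ler_distl /h -[L / _]/(L * _).
  apply: gL => //.
  move=> s; rewrite /corner /k ffunE /=; set y := x s + M.+1%:R.
  have y0 : 0 <= y.
    by rewrite -lerBlDr sub0r; have := cx s; rewrite ler_norml => /andP[].
  have /truncn_itv/andP[ty yt] : 0 <= y * N%:R by rewrite mulr_ge0.
  have -> : x s - ((Num.trunc (y * N%:R))%:R / N%:R - M.+1%:R) =
      (y * N%:R - (Num.trunc (y * N%:R))%:R) / N%:R.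
    rewrite mulrBl mulfK ?gt_eqF //; set T := _%:R / _.
    by rewrite /y; ring.
  rewrite ger0_norm ?divr_ge0 ?subr_ge0 // ler_pdivrMr // mulVf ?gt_eqF //.
  by rewrite lerBlDr nat1r ltW.
- exists (fun=> 0); rewrite (@box_volume_cst _ _ _ _ _ 0) ?expr0n; last first.
    by move=> *; rewrite subrr.
  by rewrite gtn_eqF // (leq_ltn_trans _ QD).
- under eq_bigr => k _.
    rewrite (@box_volume_cst _ _ _ _ _ (2 * h)); last first.
      by move=> *; rewrite !entry_shift; ring.
    over.
  rewrite sumr_const card_ffun card_ord -[_ *+ (_ ^ _)]mulr_natl.
  by apply: le_trans AN; apply: grid_count.
Qed.

End LipschitzImage.

(** * Costs whose slack has low rank *)

Section LowRank.
Context {R : realType}.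

(** The symmetric matrix [W *m G_II *m W^T], where [G_II] is the principal
    submatrix of [G] on [I] and the rows of [W] indexed by [I] form the identity
    while the others are the columns of [G] restricted to the rows [I].  It uses
    no entry of [G] with both indices outside [I]. *)
Definition fill n (I : {set 'I_n}) (G : 'I_n -> 'I_n -> R) (a b : 'I_n) : R :=
  let W a i := if a \in I then (a == i)%:R else G i a in
  \sum_(i in I) \sum_(j in I) W a i * W b j * G i j.

Lemma eq_fill n (I : {set 'I_n}) G G' a b :
  (forall i j, i \in I -> G i j = G' i j) -> fill I G a b = fill I G' a b.
Proof.
move=> GG'; apply: eq_bigr => i Ii; apply: eq_bigr => j Ij.
by rewrite !GG'.
Qed.

Lemma sum_delta n (I : {set 'I_n}) (a : 'I_n) (f : 'I_n -> R) : a \in I ->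
  \sum_(i in I) (a == i)%:R * f i = f a.
Proof.
move=> Ia; rewrite (bigD1 a) //= eqxx mul1r big1 ?addr0 // => i /andP[_ ia].
by rewrite eq_sym (negbTE ia) mul0r.
Qed.

Lemma fill_setT n (G : 'I_n -> 'I_n -> R) a b : fill finset.setT G a b = G a b.
Proof.
rewrite /fill /= 2!finset.in_setT.
under eq_bigr => i _ do under eq_bigr => j _ do rewrite -mulrA.
under eq_bigr => i _ do rewrite -mulr_sumr.
by rewrite sum_delta ?finset.in_setT // sum_delta ?finset.in_setT.
Qed.

(** Let [I] index rows of [S] that form a basis of its row space, so
    that [S = W *m S_I] with [S_I] these rows and [W] the identity on [I].  By
    symmetry [S_I = S_II *m W^T].  The free data are [S_II] and the rows of [W]
    outside [I]: the entries of a symmetric matrix except those with both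
    indices outside [I], which is the dimension of the variety of symmetric
    matrices of rank [#|I|]. *)
Lemma low_rank_fill n (S : 'M[R]_n) : S^T = S -> exists (I : {set 'I_n}) G,
  [/\ #|I| = \rank S, forall i j, G i j = G j i &
      forall a b, S a b = fill I G a b].
Proof.
move=> symS; set f := maxrankfun S.
have [D SD] : exists D, S = D *m rowsub f S.
  by apply/submxP; rewrite eq_maxrowsub.
pose I := f @: predT.
pose D' a i := \sum_(k | f k == i) D a k.
pose W a i := if a \in I then (a == i)%:R else D' a i.
have SW a b : S a b = \sum_(i in I) W a i * S i b.
  rewrite /W; case: (boolP (a \in I)) => Ia; first by rewrite sum_delta.
  rewrite {1}SD mxE (partition_big f (mem I)) => [|k _]; last first.
    by apply: imset_f.
  apply: eq_bigr => i _; rewrite mulr_suml; apply: eq_bigr => k /eqP <-.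
  by rewrite !mxE.
have Sab a b : S a b = S b a by rewrite -[in LHS]symS mxE.
exists I, (fun i j => if i \in I then if j \in I then S i j else D' j i
                      else if j \in I then D' i j else 0); split.
- rewrite card_imset; last exact: maxrankfun_inj.
  exact: card_ord.
- by move=> i j; case: ifP => Ii; case: ifP.
- move=> a b; rewrite SW; apply: eq_bigr => i Ii.
  rewrite [S i b]Sab SW mulr_sumr; apply: eq_bigr => j Ij.
  rewrite Ii Ij [S j i]Sab mulrA /W.
  by case: (a \in I); case: (b \in I).
Qed.

End LowRank.

(** Adding the number of pairs in increasing order to the same number for the
    decreasing order counts every pair of [J] once, and the diagonal twice. *)
Lemma card_upper_pairs n (J : {set 'I_n}) :
  #|[pred p : 'I_n * 'I_n | [&& (p.1 <= p.2)%N, p.1 \in J & p.2 \in J]]| =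
  tau #|J|.
Proof.
set T := LHS.
have TE : T = (\sum_(a in J) \sum_(b in J) (a <= b))%N.
  rewrite /T -sum1_card pair_big_dep big_mkcond [RHS]big_mkcond.
  apply: eq_bigr => -[a b] _ /=.
  by rewrite inE /=; case: (a <= b)%N; case: (a \in J); case: (b \in J).
have TT : (T + T = #|J| * #|J|.+1)%N.
  rewrite {2}TE exchange_big TE -big_split /= -sum_nat_const.
  apply: eq_bigr => a Ja; rewrite -big_split /=.
  under eq_bigr => b _.
    rewrite (_ : (a <= b) + (b <= a) = 1 + (b == a))%N; last first.
      by rewrite -val_eqE /=; case: ltngtP.
    over.
  rewrite big_split /= sum1_card (bigD1 a) //= eqxx big1 ?addn0 ?addn1 //.
  by move=> b /andP[_ /negbTE ->].
by rewrite /tau -TT addnn -muln2 mulnK.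
Qed.

Section ExceptionalSet.
Context {R : realType} {q : nat} (n : 'I_q -> nat).
Implicit Types I : forall d : 'I_q, {set 'I_(n d)}.

Definition filled I : pred (entry_ix n) := fun t =>
  upper t && ((tagged t).1 \notin I (tag t)) && ((tagged t).2 \notin I (tag t)).

(** These costs depend, through locally Lipschitz functions, on the [r]
    coefficients [z] and on the entries of [G] that are not filled; there are
    fewer such parameters than coordinates because [r < #|filled I|]. *)
Lemma lebesgue_null_fill r (v : 'I_r -> forall d, 'I_(n d) -> 'I_(n d) -> R) I :
  (r < #|filled I|)%N ->
  lebesgue_null [set C : cost R n | exists (z : 'I_r -> R)
    (G : forall d, 'I_(n d) -> 'I_(n d) -> R),
    (forall d i j, G d i j = G d j i) /\
    forall d a b, entry (C d) a b =
      \sum_i z i * v i d a b + fill (I d) (G d) a b].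
Proof.
move=> rI.
pose free : pred (entry_ix n) := fun t => upper t && ~~ filled I t.
pose Q := ('I_r + {t | free t})%type.
pose val (x : Q -> R) t := if insub t is Some s then x (inr s) else 0.
pose G (x : Q -> R) d (a b : 'I_(n d)) :=
  val x (Tagged _ (if (a <= b)%N then (a, b) else (b, a)) : entry_ix n).
(* [sympart] only serves to land in symmetric matrices: at the parameters of
   interest its argument is already symmetric. *)
pose g (x : Q -> R) : cost R n := fun d => sympart (\matrix_(a, b)
  (\sum_i x (inl i) * v i d a b + fill (I d) (G x d) a b)).
have lipG d a b : loclip (fun x => G x d a b).
  rewrite /G /val; case: insub => [s|]; first exact: loclip_coord.
  exact: loclip_cst.
have lip_ent d a b : loclip (fun x : Q -> R =>
    \sum_i x (inl i) * v i d a b + fill (I d) (G x d) a b).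
  apply: loclipD; apply: loclip_sum => i _.
    by apply: loclipM; [exact: loclip_coord|exact: loclip_cst].
  apply: loclip_sum => j _; apply: loclipM => //.
  by apply: loclipM; [case: (a \in I d)|case: (b \in I d)] => //;
    exact: loclip_cst.
apply: (@sub_lebesgue_null _ _ _ _ (range g)); last first.
  apply: lebesgue_null_loclip_image => [|d a b].
    rewrite card_sum card_ord card_sig -(cardID (filled I) (@upper q n)).
    have -> : #|[predI @upper q n & filled I]| = #|filled I|.
      apply: eq_card => t; rewrite !inE -!topredE /= /filled.
      by case: upper; rewrite ?andbF.
    have -> : #|[predD @upper q n & filled I]| = #|free|.
      by apply: eq_card => t; rewrite !inE -!topredE /= andbC.
    by rewrite ltn_add2r.
  rewrite (_ : (fun x => _) = fun x => 2^-1 *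
    ((\sum_i x (inl i) * v i d a b + fill (I d) (G x d) a b) +
     (\sum_i x (inl i) * v i d b a + fill (I d) (G x d) b a))).
    by apply: loclipM; [exact: loclip_cst|exact: loclipD].
  by apply/funext => x; rewrite /entry /= !mxE.
move=> C [z [G0 [symG CE]]].
exists (fun s => match s with
  | inl i => z i
  | inr t => G0 (tag (sval t)) (tagged (sval t)).1 (tagged (sval t)).2 end) => //.
apply: functional_extensionality_dep => d; rewrite -[RHS]sympart_id.
congr sympart; apply/matrixP => a b; rewrite mxE [RHS]CE; congr (_ + _).
apply: eq_fill => i j Ii.
have [ij|ji] := leqP i j.
  rewrite /G ij /val insubT //= /free /filled /upper /= ij Ii //.
rewrite /G leqNgt ji /= /val insubT //= /free /filled /upper /=.
by rewrite ltnW // Ii andbF.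
Qed.

Lemma upper_gt0 c : (0 < n c)%N -> (0 < #|@upper q n|)%N.
Proof.
move=> nc; pose i0 := Ordinal nc; apply/card_gt0P.
exists (Tagged (fun d => 'I_(n d) * 'I_(n d))%type (i0, i0)).
by rewrite -topredE /= /upper.
Qed.

(** With no coordinate every box has volume 1 and even the empty set is not
    null, whence the hypothesis. *)
Lemma lebesgue_null_set0 : (0 < #|@upper q n|)%N ->
  lebesgue_null (set0 : set (cost R n)).
Proof.
move=> D0; apply: lebesgue_null_finite_cover => e e0.
exists void, (of_void _), (of_void _); split.
- by case.
- by [].
- exists (fun=> 0); rewrite (@box_volume_cst _ _ _ _ _ 0); last first.
    by move=> *; rewrite subrr.
  by rewrite expr0n gtn_eqF.
- by rewrite big_pred0 ?ltW // => -[].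
Qed.

Lemma lebesgue_null_finite_bigcup (T : finType) (E : T -> set (cost R n)) :
  (0 < #|@upper q n|)%N -> (forall t, lebesgue_null (E t)) ->
  lebesgue_null (\bigcup_t E t).
Proof.
move=> D0 nullE.
apply: (@sub_lebesgue_null _ _ _ _
  (\bigcup_i (if unpickle i is Some t then E t else set0))).
  by move=> C [t _ Et]; exists (pickle t); rewrite ?pickleK.
apply: lebesgue_null_bigcup => i; case: unpickle => [t|] //.
exact: lebesgue_null_set0.
Qed.

End ExceptionalSet.

Lemma leq_tau : {homo tau : k l / (k <= l)%N}.
Proof. by move=> k l kl; rewrite leq_div2r // leq_mul. Qed.

Section LowRankSlack.
Context {R : realType} {q m : nat} {n : 'I_q -> nat}.
Variables (A : forall c, 'Hom(symmx R (n c), 'cV[R]_m)).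

Definition low_rank_slack (c : 'I_q) (k : nat) : set (cost R n) :=
  [set C | exists y, (\rank (vsval (slack A C y c)) + k <= n c)%N].

Lemma leq_tau_fixed (I : forall d, {set 'I_(n d)}) c :
  (tau #|~: I c| <= #|filled I|)%N.
Proof.
rewrite -card_upper_pairs.
have inj_pair : injective (fun p : 'I_(n c) * 'I_(n c) => Tagged _ p : entry_ix n).
  by move=> p p' /eqP; rewrite -tag_eqE /tag_eq eqxx /= tagged_asE => /eqP.
rewrite -(fintype.card_image inj_pair).
apply: subset_leq_card; apply/fintype.subsetP => t /fintype.imageP[p].
rewrite inE => /and3P[le i j] ->; move: i j; rewrite !inE => i j.
by rewrite -topredE /= /filled /upper /= le i j.
Qed.

(** Only the [\dim (limg (A c))] numbers obtained by pairing [y] with a basis of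
    the range of [A c] matter for [adj (A c) y], so the range of the adjoint has
    that many parameters. *)
Lemma inner_limg_vbasis (c : 'I_q) (y : 'cV[R]_m) (X : symmx R (n c)) :
  inner y (A c X) = \sum_(i < \dim (limg (A c)))
    inner y (vbasis (limg (A c)))`_i * coord (vbasis (limg (A c))) i (A c X).
Proof.
rewrite {1}(coord_vbasis (memv_img (A c) (memvf X))).
rewrite (linear_sum (inner y)); apply: eq_bigr => i _.
by rewrite linearZ mulrC.
Qed.

(** The cost is [adj (A c) y] plus a matrix of rank at most [n c - k] in block
    [c], and arbitrary in the other blocks.  The former has [\dim (limg (A c))]
    parameters, the latter lacks at least [tau k] of the coordinates. *)
Lemma lebesgue_null_low_rank_slack c k :
  (0 < n c)%N -> (\dim (limg (A c)) < tau k)%N ->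
  lebesgue_null (low_rank_slack c k).
Proof.
move=> nc rk; set r := \dim (limg (A c)) in rk.
pose v i d a b := (d == c)%:R *
  coord (vbasis (limg (A c))) i (A d (sympart (delta_mx a b))).
(* In the blocks other than [c] the choice [I d = setT] leaves every entry
   free, and the factor [d == c] in [v] switches the adjoint off. *)
pose E (I : {dffun forall d : 'I_q, {set 'I_(n d)}}) : set (cost R n) :=
  [set C | (k <= #|~: I c|)%N /\ exists (z : 'I_r -> R)
    (G : forall d, 'I_(n d) -> 'I_(n d) -> R),
    (forall d i j, G d i j = G d j i) /\
    forall d a b, entry (C d) a b =
      \sum_i z i * v i d a b + fill (I d) (G d) a b].
have D0 := upper_gt0 nc.
apply: (@sub_lebesgue_null _ _ _ _ (\bigcup_I E I)); last first.
  apply: lebesgue_null_finite_bigcup => // I.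
  have [kI|/negP kI] := boolP (k <= #|~: I c|)%N; last first.
    by apply: sub_lebesgue_null (lebesgue_null_set0 D0) => C [].
  apply: (sub_lebesgue_null _ (@lebesgue_null_fill _ _ _ _ v I _)).
    by move=> C [].
  by rewrite (leq_trans rk) // (leq_trans (leq_tau kI)) // leq_tau_fixed.
move=> C [y rankS].
pose z (i : 'I_r) := inner y (vbasis (limg (A c)))`_i.
have fillS d : exists IG : {set 'I_(n d)} * ('I_(n d) -> 'I_(n d) -> R),
    [/\ (d = c -> (k <= #|~: IG.1|)%N), forall i j, IG.2 i j = IG.2 j i &
     forall a b, entry (C d) a b = \sum_i z i * v i d a b + fill IG.1 IG.2 a b].
  have [->|dc] := eqVneq d c.
    have /symvP symS := valP (slack A C y c).
    have [I [G [cardI symG SG]]] := low_rank_fill symS.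
    exists (I, G); split => // [_|a b] /=.
      by rewrite -(leq_add2l #|I|) cardsC card_ord cardI.
    rewrite -SG /slack linearB /= !mxE /v eqxx inner_limg_vbasis.
    under eq_bigr => i _ do rewrite mul1r.
    by rewrite [RHS]addrC subrK.
  exists (finset.setT, entry (C d)); split => /= [/eqP||a b].
  - by rewrite (negbTE dc).
  - by move=> i j; have /symvP symC := valP (C d); rewrite /entry -[in LHS]symC mxE.
  - rewrite fill_setT big1 ?add0r // => i _.
    by rewrite /v (negbTE dc) mul0r mulr0.
pose IG d := cid (fillS d).
exists [ffun d => (sval (IG d)).1] => //; split.
  by rewrite ffunE; have [+ _ _] := svalP (IG c); apply.
exists z, (fun d => (sval (IG d)).2); split => [d|d a b].
  by have [_ + _] := svalP (IG d).
by rewrite ffunE; have [_ _ +] := svalP (IG d).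
Qed.

End LowRankSlack.

(** * Optimality and flagged blocks *)

Section Certificate.
Context {R : realType} {q m : nat} {n : 'I_q -> nat}.
Variables (b : 'cV[R]_m) (A : forall c, 'Hom(symmx R (n c), 'cV[R]_m)).
Variables (C : cost R n).

Lemma sdp_value_slack (X : cost R n) y : \sum_c A c (X c) = b ->
  sdp_value C X = inner y b + \sum_c inner (vsval (slack A C y c)) (vsval (X c)).
Proof.
move=> <-; rewrite [inner y _](linear_sum (inner y)) -big_split.
by apply: eq_bigr => c _; rewrite [RHS]addrC inner_slack subrK.
Qed.

(** Weak duality: on feasible points the value is [inner y b] plus the pairing
    with the slack, which is nonnegative in general and zero at a KKT point. *)
Lemma kkt_optimal (X : cost R n) y : kkt b A C X y -> sdp_optimal b A C X.
Proof.
case=> feasX psdS SX0; split=> // X' [AX' psdX'].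
have [AX _] := feasX.
rewrite !(sdp_value_slack y) // lerD2l big1 => [|c _]; last first.
  by rewrite /inner; have /symvP -> := valP (slack A C y c); rewrite SX0 mxtrace0.
apply: sumr_ge0 => c _; rewrite /inner.
have /symvP -> := valP (slack A C y c).
by apply: psd_trace_ge0 => //; exact/symvP/valP.
Qed.

Lemma unflagged_psd (s : stage R m n) c :
  ~ flagged A C s c -> psd (vsval (slack A C (mult s) c)).
Proof. by move=> nf; apply: no_neg_eigenvalue_psd => //; exact/symvP/valP. Qed.

Lemma terminal_kkt (s : stage R m n) :
  feasible_sosp b A C (pen s) (mult s) (fac s) -> terminal A C s ->
  kkt b A C (grams (fac s)) (mult s).
Proof.
move=> sosp term; split.
- split=> [|c]; last exact: psd_gram.
  by have [/eqP + _ _] := sosp; rewrite /constr subr_eq0 => /eqP.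
- by move=> c; exact: unflagged_psd.
- by move=> c; rewrite /= mulmxA (sosp_stationary sosp) mul0mx.
Qed.

Definition exceptional (k : 'I_q -> nat) : set (cost R n) :=
  \bigcup_c [set C | (\dim (limg (A c)) < tau (k c))%N /\
                     low_rank_slack A c (k c) C].

(** The dichotomy: dependent columns make the slack positive semidefinite;
    independent ones bound its rank by [n c - kgen c], which is excluded for a
    cost outside the exceptional set unless it means that the slack is 0. *)
Lemma not_flagged (k0 : 'I_q -> nat) (s : stage R m n) c :
  ~ exceptional (kgen A k0) C ->
  feasible_sosp b A C (pen s) (mult s) (fac s) ->
  (kgen A k0 c <= prof s c)%N -> ~ flagged A C s c.
Proof.
move=> CE sosp kc; apply: psd_no_neg_eigenvalue.
have [rankF|rankF] := ltnP (\rank (block (fac s) c)) (prof s c).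
  exact: rank_deficient_psd sosp rankF.
have rankS : (\rank (vsval (slack A C (mult s) c)) + kgen A k0 c <= n c)%N.
  apply: leq_trans (mulmx0_rank_max (sosp_stationary sosp c)).
  by rewrite leq_add2l (leq_trans kc).
have : kgen_pred A k0 c (kgen A k0 c) by rewrite /kgen; case: ex_minnP.
move=> /andP[_ /orP[nk|rk]]; last first.
  by exfalso; apply: CE; exists c => //; split => //; exists (mult s).
have /eqP : \rank (vsval (slack A C (mult s) c)) = 0%N by lia.
by rewrite mxrank_eq0 => /eqP -> x; rewrite mul0mx linear0.
Qed.

End Certificate.

(** Although there are infinitely many profiles [k], an exceptional set is
    a union over the blocks of sets that depend on a single rank [k c], so a
    countable union remains. *)
Lemma lebesgue_null_exceptional_bigcup (R : realType) (q m : nat)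
    (n : 'I_q -> nat) (A : forall c, 'Hom(symmx R (n c), 'cV[R]_m)) :
  (0 < q)%N -> (forall c, 0 < n c)%N ->
  lebesgue_null (\bigcup_k exceptional A k).
Proof.
move=> q_gt0 n_gt0; have D0 := upper_gt0 (n_gt0 (Ordinal q_gt0)).
apply: (@sub_lebesgue_null _ _ _ _ (\bigcup_c \bigcup_(j : nat)
  [set C | (\dim (limg (A c)) < tau j)%N /\ low_rank_slack A c j C])).
  by move=> C [k _ [c _ Ec]]; exists c => //; exists (k c).
apply: lebesgue_null_finite_bigcup => // c; apply: lebesgue_null_bigcup => j.
have [rj|/negP rj] := boolP (\dim (limg (A c)) < tau j)%N.
  by apply: sub_lebesgue_null (lebesgue_null_low_rank_slack (n_gt0 c) rj) => C [].
by apply: sub_lebesgue_null (lebesgue_null_set0 D0) => C [].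
Qed.

Lemma kgen_ge (R : realType) q m (n : 'I_q -> nat)
    (A : forall c, 'Hom(symmx R (n c), 'cV[R]_m)) k0 c : (k0 c <= kgen A k0 c)%N.
Proof. by rewrite /kgen; case: ex_minnP => k /andP[]. Qed.

(** * Counting updates *)

(** After [N] steps the value is [minn (k0 + N * r) K], and the last of these
    steps started strictly below [K]. *)
Lemma truncated_steps (k : nat -> nat) (k0 K r T : nat) : (k0 <= K)%N ->
  k 0%N = k0 ->
  (forall t, (t < T)%N -> k t.+1 = k t \/
     (k t < K)%N /\ k t.+1 = minn (k t + r) K) ->
  exists2 N, (\sum_(t < T) (k t < k t.+1) = N)%N & (0 < N -> k0 + N.-1 * r < K)%N.
Proof.
move=> k0K kk0 step.
suff /(_ T (leqnn T)) [_ ?] : forall t, (t <= T)%N ->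
    let N := (\sum_(s < t) (k s < k s.+1))%N in
    (k t = minn (k0 + N * r) K) /\ (0 < N -> k0 + N.-1 * r < K)%N.
  by eexists.
elim=> [_|t IH tT] /=; first by rewrite big_ord0 addn0 kk0; lia.
have [kt Nt] := IH (ltnW tT); rewrite big_ord_recr /=.
set N := (\sum_(s < t) (k s < k s.+1))%N in kt Nt *.
have [kE|[ktK kE]] := step t tT; first by rewrite kE ltnn addn0.
have : (k0 + N * r < K)%N by lia.
have [r0|r0] := posnP r.
  by rewrite (_ : (k t < k t.+1)%N = false) ?addn0 //; lia.
move=> NK; have -> : (k t < k t.+1)%N by lia.
by rewrite addn1 /= mulSn; lia.
Qed.

Lemma le_ceil_steps (R : realType) (N D r : nat) :
  (0 < r)%N -> (0 < N -> N.-1 * r < D)%N ->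
  N%:Z <= Num.ceil (D%:R / r%:R : R).
Proof.
move=> r0; have r0' : 0 < r%:R :> R by rewrite ltr0n.
case: N => [_|N /(_ isT) /= ND].
  by rewrite ceil_ge0 (lt_le_trans (ltrN10 R)) // divr_ge0.
by rewrite -addn1 PoszD lezD1 ceil_gt_int ltr_pdivlMr // -natrM ltr_nat.
Qed.

(** * The product staircase *)

Theorem corollary1 (R : realType) (q m : nat) (n : 'I_q -> nat)
    (b : 'cV[R]_m) (A : forall c : 'I_q, 'Hom(symmx R (n c), 'cV[R]_m))
    (k0 : 'I_q -> nat)
    (q_gt0 : (0 < q)%N) (m_gt0 : (0 < m)%N)
    (n_gt0 : forall c, (0 < n c)%N) (k0_gt0 : forall c, (0 < k0 c)%N)
    (M0 : constr_set b A k0 !=set0) :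
  exists Eprof : ('I_q -> nat) -> set (cost R n),
    (forall k, profiles_between k0 (kgen A k0) k -> lebesgue_null (Eprof k)) /\
    lebesgue_null (\bigcup_(k in profiles_between k0 (kgen A k0)) Eprof k) /\
    forall C : cost R n,
      ~ (\bigcup_(k in profiles_between k0 (kgen A k0)) Eprof k) C ->
    forall (st : nat -> stage R m n) (T : nat),
      staircase b A C k0 st T ->
      (forall t, (t <= T)%N ->
        (forall c, (prof (st t) c <= kgen A k0 c)%N) ->
        smooth_profile b A (prof (st t))) ->
      [/\ (* (i) *)
          (forall t c, (t <= T)%N -> (kgen A k0 c <= prof (st t) c)%N ->
             ~ flagged A C (st t) c /\
             ((t < T)%N -> prof (st t.+1) c = prof (st t) c)) /\
          ((forall t c, (t < T)%N -> (prof (st t) c < kgen A k0 c)%N ->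
              (prof (st t.+1) c <= kgen A k0 c)%N) ->
           forall t c, (t <= T)%N -> (prof (st t) c <= kgen A k0 c)%N),
          (* (ii) *)
          forall rinc : 'I_q -> nat,
            (forall c, (0 < rinc c)%N) ->
            (forall t c, (t < T)%N ->
               (prof (st t) c < prof (st t.+1) c)%N ->
               (prof (st t) c < kgen A k0 c)%N ->
               prof (st t.+1) c = minn (prof (st t) c + rinc c) (kgen A k0 c)) ->
            (updates st T)%:Z <=
              \sum_(c < q) Num.ceil ((kgen A k0 c - k0 c)%N%:R / (rinc c)%:R : R) &
          (* (iii) *)
          terminal A C (st T) ->
            kkt b A C (grams (fac (st T))) (mult (st T)) /\
            sdp_optimal b A C (grams (fac (st T)))].
Proof.
exists (exceptional A); split; last split.
- move=> k _.
  apply: sub_lebesgue_null (lebesgue_null_exceptional_bigcup A q_gt0 n_gt0).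
  by move=> C Ck; exists k.
- apply: sub_lebesgue_null (lebesgue_null_exceptional_bigcup A q_gt0 n_gt0).
  by move=> C [k _ Ck]; exists k.
move=> C CE st T [st0 sosp _ step] _.
have notE : ~ exceptional A (kgen A k0) C.
  move=> Ck; apply: CE; exists (kgen A k0) => // c.
  by rewrite kgen_ge leqnn.
have nf t c : (t <= T)%N -> (kgen A k0 c <= prof (st t) c)%N ->
    ~ flagged A C (st t) c.
  by move=> tT; have [_ sospt] := sosp t tT; exact: not_flagged notE sospt.
have stays t c : (t < T)%N -> (kgen A k0 c <= prof (st t) c)%N ->
    prof (st t.+1) c = prof (st t) c.
  move=> tT kc; have [_ unfl] := step t c tT.
  by apply: unfl; apply: nf => //; exact: ltnW.
split.
- split=> [t c tT kc|grow].
    by split=> [|tT']; [exact: nf|exact: stays].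
  elim=> [|t IH] c tT; first by rewrite st0 kgen_ge.
  have [kc|kc] := ltnP (prof (st t) c) (kgen A k0 c); first exact: grow.
  by rewrite stays // IH // ltnW.
- move=> rinc rinc0 grow.
  have -> : (updates st T)%:Z =
      \sum_(c < q) (\sum_(t < T) (prof (st t) c < prof (st t.+1) c))%N%:Z.
    rewrite -(big_morph Posz PoszD (erefl 0%:Z)) exchange_big; congr Posz.
    apply: eq_bigr => t _; rewrite -sum1_card big_mkcond.
    by apply: eq_bigr => c _; rewrite inE; case: ltnP.
  apply: ler_sum => c _.
  have [] := @truncated_steps (fun t => prof (st t) c) (k0 c) (kgen A k0 c)
    (rinc c) T (kgen_ge A k0 c) (st0 c).
    move=> t tT; have [fl unfl] := step t c tT.
    have [fc|/unfl ->] := pselect (flagged A C (st t) c); last by left.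
    right; have kc : (prof (st t) c < kgen A k0 c)%N.
      by rewrite ltnNge; apply/negP => /(nf t c (ltnW tT)).
    by split => //; apply: grow => //; exact: fl.
  move=> N -> NK; apply: le_ceil_steps => // N0.
  by rewrite ltn_subRL; exact: NK.
- move=> term; have [_ sospT] := sosp T (leqnn T).
  have kktT := terminal_kkt sospT term.
  by split=> //; exact: kkt_optimal kktT.
Qed.
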